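(* Let $\mathfrak{g}=\mathfrak{g}_0\oplus\mathfrak{g}_1$ be a finite dimensional Lie superalgebra over $\mathbb{C}$ such that $\mathfrak{g}_0$ is reductive and there is a nondegenerate even invariant bilinear form $B$ on $\mathfrak{g}$; use $B$ to identify $\mathfrak{g}_0^*$ with $\mathfrak{g}_0$. For $x\in\mathfrak{g}_0$, let $\mathfrak{g}^x$ be the centralizer of $x$ in $\mathfrak{g}$, with odd part $\mathfrak{g}_1^x$. Then $$k(m_x)=\dim\mathfrak{g}_1-\dim\mathfrak{g}_1^x.$$
   Context: $m_x$ is the maximal ideal of $S(\mathfrak{g}_0)$ corresponding to $x$, i.e. the kernel of the algebra homomorphism $S(\mathfrak{g}_0)\to\mathbb{C}$ with $y\mapsto B(x,y)$ for $y\in\mathfrak{g}_0$. For a prime ideal $q$ of $S(\mathfrak{g}_0)$, $k(q)$ is the rank over $\mathrm{Fract}(S(\mathfrak{g}_0)/q)$ of the matrix $([v_i,v_j])_{i,j}$ reduced modulo $q$, where $(v_i)$ is a basis of $\mathfrak{g}_1$ and $[v_i,v_j]\in\mathfrak{g}_0\subset S(\mathfrak{g}_0)$. *)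

(* Defs.v *)
From HB Require Import structures.
From mathcomp Require Import all_boot all_order all_algebra.
From mathcomp Require Import sesquilinear generic_quotient ring_quotient fraction.
From mathcomp Require Import boolp reals complex mpoly.

Set Implicit Arguments.
Unset Strict Implicit.
Unset Printing Implicit Defensive.

Import GRing.Theory.

Local Open Scope ring_scope.
Local Open Scope quotient_scope.

(* [gpart false] is the even part and [gpart true] the odd part. These axioms *)
(* are the usual ones when 6 is invertible in F; in characteristic 2 or 3     *)
(* further axioms would be required.                                          *)
HB.mixin Record isLieSuperalgebra (F : fieldType) g of Vector F g := {
  gpart : bool -> {vspace g};
  lie : g -> g -> g;
  lie_bilinear : bilinear_for *:%R *:%R lie;
  gpart_sum : (gpart false + gpart true = fullv)%VS;
  gpart_cap : (gpart false :&: gpart true = 0)%VS;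
  lie_gpart : forall a b x y, x \in gpart a -> y \in gpart b ->
    lie x y \in gpart (a (+) b);
  lie_skew : forall a b x y, x \in gpart a -> y \in gpart b ->
    lie x y = - ((-1) ^+ (a && b) *: lie y x);
  lie_jacobi : forall a b x y z, x \in gpart a -> y \in gpart b ->
    lie x (lie y z) = lie (lie x y) z + (-1) ^+ (a && b) *: lie y (lie x z)
}.

#[short(type="lieSuperalgType")]
HB.structure Definition LieSuperalgebra (F : fieldType) :=
  {g of isLieSuperalgebra F g & Vector F g}.

Arguments gpart {F} s.

HB.instance Definition _ (F : fieldType) (g : lieSuperalgType F) :=
  bilinear_isBilinear.Build F g g g *:%R *:%R (@lie F g) lie_bilinear.
HB.instance Definition _ (F : fieldType) (g : lieSuperalgType F) (x : g) :=
  GRing.isLinear.Build F g g *:%R (lie x) (lie_bilinear.2 x).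

Section LieSuperalgebraTheory.
Variables (F : fieldType) (g : lieSuperalgType F).

Definition even_ideal (I : {vspace g}) : Prop :=
  (I <= gpart g false)%VS /\
  forall x y, x \in gpart g false -> y \in I -> lie x y \in I.

(* The adjoint representation of the even part is semisimple: every ideal     *)
(* (= submodule) has a complementary ideal.                                   *)
Definition even_reductive : Prop :=
  forall I, even_ideal I -> exists J,
    [/\ even_ideal J, (I + J = gpart g false)%VS & (I :&: J = 0)%VS].

Definition centralizer (x : g) : {vspace g} := lker (linfun (lie x)).

Lemma mem_centralizer x y : (y \in centralizer x) = (lie x y == 0).
Proof. by rewrite memv_ker lfunE. Qed.

Implicit Type B : {bilinear g -> g -> F | *%R & *%R}.

Definition even_form B : Prop :=
  forall x y, x \in gpart g false -> y \in gpart g true ->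
    B x y = 0 /\ B y x = 0.

Definition invariant_form B : Prop :=
  forall x y z, B (lie x y) z = B x (lie y z).

Definition nondegenerate_form B : Prop :=
  (forall x, (forall y, B x y = 0) -> x = 0) /\
  (forall y, (forall x, B x y = 0) -> y = 0).

End LieSuperalgebraTheory.

Section SymmetricAlgebra.
Variables (F : fieldType) (V : vectType F).

(* S(V) is realised as the polynomial ring on the basis [vbasis fullv].       *)
Definition symalg := {mpoly F[\dim {:V}]}.

HB.instance Definition _ := GRing.ComAlgebra.on symalg.
HB.instance Definition _ := GRing.IntegralDomain.on symalg.

Definition sym_in (y : V) : symalg :=
  \sum_i coord (vbasis {:V}) i y *: 'X_i.

Definition sym_ev (f : V -> F) (p : symalg) : F :=
  p.@[fun i => f (vbasis {:V})`_i].

(* [sym_ev f] is the unique algebra morphism extending the linear form f.     *)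
Lemma sym_ev_in (f : {scalar V}) y : sym_ev f (sym_in y) = f y.
Proof.
rewrite /sym_ev /sym_in raddf_sum /= [in RHS](coord_vbasis (memvf y)).
rewrite raddf_sum; apply: eq_bigr => i _.
by rewrite /= mevalZ mevalXU linearZ.
Qed.

Lemma sym_ev_unique (f : {scalar V}) (h : {lrmorphism symalg -> F | *%R}) :
  (forall y, h (sym_in y) = f y) -> forall p, h p = sym_ev f p.
Proof.
move=> hf p; have hX i : h 'X_i = f (vbasis {:V})`_i.
  rewrite -hf /sym_in (bigD1 i) //= coord_free ?(basis_free (vbasisP _)) //.
  rewrite eqxx scale1r big1 ?addr0 // => j /negPf ji.
  rewrite coord_free ?(basis_free (vbasisP _)) //.
  by rewrite eq_sym ji scale0r.
rewrite /sym_ev mevalE [in LHS](mpolyE p) raddf_sum /=.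
apply: eq_bigr => m _; rewrite linearZ /=; congr (_ * _).
rewrite mpolyXE_id rmorph_prod; apply: eq_bigr => i _.
by rewrite rmorphXn; congr (_ ^+ _); apply: hX.
Qed.

Lemma sym_ev1 f : sym_ev f 1 = 1. Proof. exact: meval1. Qed.
Lemma sym_ev0 f : sym_ev f 0 = 0. Proof. exact: meval0. Qed.
Lemma sym_evD f : {morph sym_ev f : p q / p + q}. Proof. exact: mevalD. Qed.
Lemma sym_evM f : {morph sym_ev f : p q / p * q}. Proof. exact: mevalM. Qed.

End SymmetricAlgebra.

Section PrimeQuotient.
Variables (S : comNzRingType) (q : prime_idealr S).

Definition prime_quot := {ideal_quot q}.

HB.instance Definition _ := GRing.ComNzRing.on prime_quot.

Definition prime_quot_unit : {pred prime_quot} :=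
  fun x => `[< exists y, y * x = 1 >].

Definition prime_quot_inv (x : prime_quot) : prime_quot :=
  if pselect (exists y, y * x = 1) is left e then projT1 (cid e) else x.

Fact prime_quot_mulVr :
  {in prime_quot_unit, left_inverse 1 prime_quot_inv *%R}.
Proof.
move=> x /asboolP ex; rewrite /prime_quot_inv.
by case: pselect => // e; case: (cid e).
Qed.

Fact prime_quot_unitPl (x y : prime_quot) : y * x = 1 -> prime_quot_unit x.
Proof. by move=> yx; apply/asboolP; exists y. Qed.

Fact prime_quot_inv_out :
  {in [predC prime_quot_unit], prime_quot_inv =1 id}.
Proof.
move=> x /asboolP nx; rewrite /prime_quot_inv.
by case: pselect.
Qed.

HB.instance Definition _ := GRing.ComNzRing_hasMulInverse.Build prime_quot
  prime_quot_mulVr prime_quot_unitPl prime_quot_inv_out.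
HB.instance Definition _ := GRing.ComUnitRing_isIntegral.Build prime_quot
  (@Quotient.rquot_IdomainAxiom S q).

Definition to_prime_quot (a : S) : prime_quot := \pi_{ideal_quot q} a.

Definition residue (a : S) : {fraction prime_quot} :=
  FracField.tofrac (to_prime_quot a).

End PrimeQuotient.

Section Rank.
Variables (F : fieldType) (g : lieSuperalgType F).

Definition even_alg : vectType F := subvs_of (gpart g false).

(* [vsproj] sends an element of the even part to itself, so this is the       *)
(* bracket of two odd elements viewed in S(g_0).                              *)
Definition sym_lie (x y : g) : symalg even_alg :=
  sym_in (vsproj (gpart g false) (lie x y)).

Definition krank n (v : n.-tuple g) (q : prime_idealr (symalg even_alg)) : nat :=
  \rank (\matrix_(i < n, j < n) residue q (sym_lie (tnth v i) (tnth v j))).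

Definition max_ideal (B : {bilinear g -> g -> F | *%R & *%R}) (x : g) :
  {pred symalg even_alg} :=
  fun p => sym_ev (fun y : even_alg => B x (vsval y)) p == 0.

Section MaxIdeal.
Variables (B : {bilinear g -> g -> F | *%R & *%R}) (x : g).

Fact max_ideal_idealr : idealr_closed (max_ideal B x).
Proof.
split; rewrite ?unfold_in /max_ideal /= ?sym_ev0 ?sym_ev1 ?oner_eq0 //.
move=> a p r; rewrite !unfold_in /max_ideal /= => /eqP p0 /eqP r0.
by rewrite sym_evD sym_evM p0 r0 mulr0 addr0.
Qed.

Fact max_ideal_prime : prime_idealr_closed (max_ideal B x).
Proof. by move=> p r; rewrite !unfold_in /max_ideal /= sym_evM mulf_eq0. Qed.

HB.instance Definition _ :=
  isIdealr.Build (symalg even_alg) (max_ideal B x) max_ideal_idealr.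
HB.instance Definition _ :=
  isPrimeIdealrClosed.Build (symalg even_alg) (max_ideal B x) max_ideal_prime.

End MaxIdeal.
End Rank.

(* Main.v *)
Require Import Defs.
From HB Require Import structures.
From mathcomp Require Import all_boot all_order all_algebra.
From mathcomp Require Import sesquilinear ring_quotient fraction mpoly.
From mathcomp Require Import reals complex.

(** Modulo [m_x] a polynomial is congruent to the scalar obtained by evaluating
    it at [x], so the matrix [([v_i, v_j])] reduces to the scalar matrix of the
    form [(v, w) |-> B(x, [v, w]) = B([x, v], w)] on the odd part. Since [B] is
    nondegenerate on the odd part, the kernel of this form is the kernel of
    [ad x], and rank-nullity concludes. *)

Set Implicit Arguments.
Unset Strict Implicit.
Unset Printing Implicit Defensive.

Import GRing.Theory VectorInternalTheory.

Local Open Scope ring_scope.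

Section ResidueMorphism.
Variables (S : comNzRingType) (q : prime_idealr S).

Fact residue_is_zmod_morphism : zmod_morphism (residue q).
Proof. by move=> a b; rewrite /residue /to_prime_quot !rmorphB. Qed.

Fact residue_is_monoid_morphism : monoid_morphism (residue q).
Proof.
by split=> [|a b]; rewrite /residue /to_prime_quot ?rmorph1 ?rmorphM.
Qed.

HB.instance Definition _ :=
  GRing.isZmodMorphism.Build S {fraction prime_quot q} (residue q)
    residue_is_zmod_morphism.
HB.instance Definition _ :=
  GRing.isMonoidMorphism.Build S {fraction prime_quot q} (residue q)
    residue_is_monoid_morphism.

(** The two classes already agree in the quotient, before passing to fractions. *)
Lemma residue_eq a b : a - b \in q -> residue q a = residue q b.
Proof.
rewrite Quotient.idealrBE => /eqP ab.
by congr (FracField.tofrac _); exact: ab.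
Qed.

End ResidueMorphism.

Lemma dim_span_b2mx (F : fieldType) (V : vectType F) n (X : n.-tuple V) :
  \dim <<X>>%VS = \rank (b2mx X).
Proof.
have -> : <<X>>%VS = mx2vs (b2mx X).
  by rewrite unlock tvalK; case: _ / (esym _).
by rewrite /dimv genmxE.
Qed.

(** The span of the rows is computed through the abstract coordinates [v2r] of the space of row
    vectors. This coordinate change is invertible, so it preserves rank. *)
Lemma mxrank_span (F : fieldType) m n (A : 'M[F]_(m, n)) :
  \rank A = \dim <<[tuple row i A | i < m]>>%VS.
Proof.
pose L := lin1_mx (@v2r F 'rV[F]_n).
have L_free : row_free L.
  apply/row_freeP; exists (lin1_mx r2v); apply/row_matrixP => i.
  by rewrite row_mul !mul_rV_lin1 !rowE mul_rV_lin1 /= v2rK mulmx1.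
rewrite -(mxrankMfree A L_free) dim_span_b2mx; congr (\rank _).
by apply/row_matrixP => i; rewrite row_mul mul_rV_lin1 rowK tnth_mktuple.
Qed.

(** Subtracting from [p] its value at [x] gives a polynomial that vanishes at [x]. *)
Lemma residue_max_ideal (F : fieldType) (g : lieSuperalgType F)
    (B : {bilinear g -> g -> F | *%R & *%R}) (x : g)
    (p : symalg (even_alg g)) :
  residue (max_ideal B x) p =
    residue (max_ideal B x)
      (in_alg _ (sym_ev (fun y : even_alg g => B x (vsval y)) p)).
Proof.
apply: residue_eq; rewrite unfold_in /max_ideal /=.
by rewrite /sym_ev mevalB mevalZ meval1 mulr1 subrr.
Qed.

Lemma krank_max_ideal (F : fieldType) (g : lieSuperalgType F)
    (B : {bilinear g -> g -> F | *%R & *%R}) (x : g)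
    n (v : n.-tuple g) (v_odd : {subset v <= gpart g true}) :
  krank v (max_ideal B x) =
    \rank (\matrix_(i < n, j < n) B x (lie (tnth v i) (tnth v j))).
Proof.
(* [phi] embeds the scalars into the residue field; a field morphism preserves the rank of a
   matrix. *)
pose phi : {rmorphism F -> {fraction prime_quot (max_ideal B x)}} :=
  residue (max_ideal B x) \o in_alg (symalg (even_alg g)).
rewrite -(mxrank_map phi) /krank; congr (\rank _).
apply/matrixP => i j; rewrite !mxE residue_max_ideal; congr (phi _).
pose f : {scalar even_alg g} := B x \o vsval.
rewrite (sym_ev_in f) /= vsprojK //.
(* The bracket of two odd elements is even, so [vsproj] fixes it. *)
by rewrite -[false]/(true (+) true); apply: lie_gpart; apply/v_odd/mem_tnth.
Qed.

(** An odd [y] is orthogonal to the even part because the form is even, so orthogonality to the odd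
    part already gives orthogonality to all of [g]. *)
Lemma nondegenerate_odd (F : fieldType) (g : lieSuperalgType F)
    (B : {bilinear g -> g -> F | *%R & *%R}) (y : g) :
  nondegenerate_form B -> even_form B -> y \in gpart g true ->
  (forall z, z \in gpart g true -> B y z = 0) -> y = 0.
Proof.
move=> [nondeg _] evenB y1 yB; apply: nondeg => z.
have: z \in (gpart g false + gpart g true)%VS by rewrite gpart_sum memvf.
case/memv_addP => z0 z0P [z1 z1P ->].
by rewrite linearDr (evenB _ _ z0P y1).2 yB // addr0.
Qed.

Theorem lemma6p1 (R : realType) (g : lieSuperalgType R[i])
    (B : {bilinear g -> g -> R[i] | *%R & *%R})
    (g0_reductive : even_reductive g)
    (B_nondegenerate : nondegenerate_form B)
    (B_even : even_form B) (B_invariant : invariant_form B)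
    (n : nat) (v : n.-tuple g) (v_basis : basis_of (gpart g true) v)
    (x : g) (x_even : x \in gpart g false) :
  krank v (max_ideal B x) =
    (\dim (gpart g true) - \dim (centralizer x :&: gpart g true)%VS)%N.
Proof.
have v_odd : {subset v <= gpart g true} by move=> y; apply: basis_mem.
rewrite krank_max_ideal //.
(* [f y] lists the values of the functional [B (lie x y)] on the odd basis; by invariance, [f] sends
   the basis vectors to the rows of the matrix. *)
pose f (y : g) : 'rV[R[i]]_n := \row_j B (lie x y) (tnth v j).
have f_linear : linear f.
  move=> a y z; apply/rowP => j; rewrite !mxE.
  by rewrite linearP /= linearDl linearZl_LR.
pose fL : {linear g -> 'rV[R[i]]_n} :=
  HB.pack f (GRing.isLinear.Build _ _ _ _ f f_linear).
have f_ker y : y \in gpart g true -> (f y == 0) = (lie x y == 0).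
  move=> y1; apply/eqP/eqP => [fy0 | xy0]; last first.
    by apply/rowP => j; rewrite !mxE xy0 linear0l.
  apply: (nondegenerate_odd B_nondegenerate B_even).
    by rewrite -[true]/(false (+) true); apply: lie_gpart.
  move=> z /(coord_basis v_basis) ->; rewrite linear_sumr big1 // => j _.
  rewrite linearZr_LR /= -tnth_nth.
  by have /rowP/(_ j) := fy0; rewrite !mxE => ->; rewrite mulr0.
have -> : (centralizer x :&: gpart g true =
           gpart g true :&: lker (linfun fL))%VS.
  apply/vspaceP => y.
  rewrite !memv_cap mem_centralizer memv_ker lfunE /= andbC.
  by case: (boolP (y \in _)) => //= /f_ker ->.
(* Rank-nullity for [f] on the odd part: the difference of dimensions is the dimension of the image,
   which the rows [f (tnth v i)] span. *)
rewrite -(limg_ker_dim (linfun fL) (gpart g true)) addKn.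
rewrite -(span_basis v_basis) limg_span mxrank_span; congr (\dim (span _)).
rewrite -[in RHS](map_tnth_enum v) -map_comp; apply: eq_map => i /=.
by apply/rowP => j; rewrite (lfunE fL) !mxE /= B_invariant.
Qed.
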